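(* Let $u(n)$, $n \ge 0$, be the version of the Thue-Morse sequence with $u(n) = 1$ if $s_2(n)$ is even and $u(n)=2$ if $s_2(n)$ is odd, and let $c(n) = \sum_{i=0}^n u(i)\,u(n-i)$ be its convolution with itself. Then $c(n) \equiv m(n) \pmod 2$ for all $n \ge 0$.
   Context: For a non-negative integer $k$, $s_2(k)$ denotes the number of ones in the binary expansion of $k$. Define $\bar{t}(k) = 1$ if $s_2(k)$ is even and $\bar{t}(k)=0$ if $s_2(k)$ is odd. The sequence $m(n)$, $n \ge 0$, is defined by $m(2k) = \bar{t}(k)$ and $m(2k+1) = 0$ for all $k \ge 0$. The sequence $u$ is OEIS A001285 ($1,2,2,1,2,1,1,2,\ldots$) and $c$ is OEIS A029886, indexed from $n=0$: $1,4,8,10,12,14,15,\ldots$. *)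

(* Defs.v *)
From mathcomp Require Import all_boot.

Set Implicit Arguments.
Unset Strict Implicit.
Unset Printing Implicit Defensive.

(* The binary digit of k at position i is odd (k %/ 2 ^ i), with bool coerced
   to nat. Since k < 2 ^ k, all digits at positions i >= k vanish. *)
Definition s2 (k : nat) : nat := \sum_(i < k) odd (k %/ 2 ^ i).

Definition tbar (k : nat) : nat := if odd (s2 k) then 0 else 1.

Definition m (n : nat) : nat := if odd n then 0 else tbar n./2.

(* OEIS A001285 *)
Definition u (n : nat) : nat := if odd (s2 n) then 2 else 1.

(* OEIS A029886 *)
Definition c (n : nat) : nat := \sum_(0 <= i < n.+1) u i * u (n - i).

(* Main.v *)
(* The involution [i |-> n - i] pairs off equal terms of the self-convolution,
   so modulo 2 only its fixed point [i = n / 2] contributes, when [n] is even. *)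
Require Import Defs.
From mathcomp Require Import all_boot.

(** For [n = 2k] the surviving middle term of the convolution is [u k * u k], which is odd exactly
    when [u k = 1], that is, when [tbar k = 1]. *)

Lemma odd_sum_palindrome (n : nat) (g : nat -> nat) :
    (forall i, i <= n -> g (n - i) = g i) ->
  odd (\sum_(0 <= i < n.+1) g i) = ~~ odd n && odd (g n./2).
Proof.
elim/ltn_ind: n g => -[|[|n]] IHn g g_sym.
- by rewrite big_nat1.
- by rewrite big_nat_recr //= big_nat1 -(g_sym 0) // addnn odd_double.
(* The two end terms are equal and add up to an even number; the inner terms form a palindrome for
   the shifted [g], two shorter. *)
rewrite big_nat_recl // big_nat_recr //= -(g_sym 0) // subn0 addnCA addnn.
rewrite oddD odd_double addbF (IHn n _ (fun i => g i.+1)) //= ?negbK //.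
by move=> i le_in; rewrite -subSn // -subSS g_sym // ltnW.
Qed.

Theorem lemma4 (n : nat) : c n = m n %[mod 2].
Proof.
rewrite !modn2 /c odd_sum_palindrome => [|i le_in]; last first.
  by rewrite subKn // mulnC.
rewrite /m /u /tbar; case: (boolP (odd n)) => //= even_n.
(* Since [n] is even, [n - n./2] is [n./2], so the term is a square. *)
rewrite -{2}(even_halfK even_n) -addnn addnK oddM andbb.
by case: (odd (s2 _)).
Qed.
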